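(* Let $\gamma$ be a strong composition. The quasisymmetric Jack polynomial $G_\gamma(X;\alpha)$ with parameter $\alpha$ has the following fundamental expansion: \begin{align*} G_{\gamma}(X;\alpha)=&\sum_{\tau\in\mathrm{ST}(\gamma)} \left( \prod_{u\in W(\tau)} \bigl(\alpha(\mathrm{leg}(u)+1)+\mathrm{arm}(u)+1\bigr) \right) \\ &\times \sum_{U \subseteq W(\tau)} (-1)^{|U|} \left( \prod_{u \in U} \frac{\alpha(\mathrm{leg}(u)+1)+\mathrm{arm}(u)}{\alpha(\mathrm{leg}(u)+1)+\mathrm{arm}(u)+1} \right)F_{V(\tau)\cup U}. \end{align*} Here, for $u\in W(\tau)$, $\mathrm{leg}(u)$ and $\mathrm{arm}(u)$ are computed in the diagram $\mathrm{dg}(\mathrm{inc}(\gamma))$ of which $\tau$ is a filling.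
   Context: Compositions and diagrams. A strong composition $\gamma=(\gamma_1,\dots,\gamma_\ell)$ of $n=|\gamma|=\sum_i\gamma_i$ is a finite list of positive integers. $\mathrm{inc}(\gamma)$ is the list obtained by sorting the parts of $\gamma$ in weakly increasing order, and $\lambda$ denotes the partition obtained by sorting the parts of $\gamma$ in weakly decreasing order. $\beta(\gamma)$ is the permutation $\sigma\in S_\ell$ of greatest length (number of inversions of its one-line word) with $\gamma_{\sigma_j}=\mathrm{inc}(\gamma)_j$ for all $j$; i.e. its one-line word lists the positions of the parts of $\gamma$ in weakly increasing order of part size, positions of equal parts being listed in decreasing order. For a composition $\mu$, the diagram $\mathrm{dg}(\mu)$ has $\mu_i$ cells in column $i$ (columns numbered left to right, bottom-justified, rows numbered from bottom to top starting at 1); cell $(r,c)$ is in row $r$, column $c$. All tableaux attached to $\gamma$ are fillings of $\mathrm{dg}(\mathrm{inc}(\gamma))$, and $\widehat{\mathrm{dg}}(\gamma)$ denotes the set of cells of $\mathrm{dg}(\mathrm{inc}(\gamma))$ not in the bottom row. A filling $T$ assigns a positive integer $T(u)$ to every cell $u$; $x^T=\prod_u x_{T(u)}$. $\mathrm{South}(u)$ is the cell directly below $u$. Statistics. For a cell $u=(r,i)$ of a diagram $\mathrm{dg}(\mu)$: $\mathrm{leg}(u)$ is the number of cells above $u$ in its column; the arm of $u$ consists of the cells $(r,j)\in\mathrm{dg}(\mu)$ with $j>i$, $\mu_j\le\mu_i$ and the cells $(r-1,j)\in\mathrm{dg}(\mu)$ with $j<i$, $\mu_j<\mu_i$, and $\mathrm{arm}(u)$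 is its cardinality. For a filling $T$ of $\mathrm{dg}(\mathrm{inc}(\gamma))$, $\mathrm{Des}(T)=\{u\in\widehat{\mathrm{dg}}(\gamma): T(u)>T(\mathrm{South}(u))\}$ and $\mathrm{maj}(T)=\sum_{u\in\mathrm{Des}(T)}(\mathrm{leg}(u)+1)$. A triple consists of a cell $x\in\widehat{\mathrm{dg}}(\gamma)$, the cell $y=\mathrm{South}(x)$, and a cell $z$ in the arm of $x$. It is a coinversion triple if $T(x)<T(z)<T(y)$ or $T(z)<T(y)<T(x)$ or $T(y)<T(x)<T(z)$. $\mathrm{coinv}(T)$ is the number of coinversion triples. Non-attacking fillings and $G_\gamma$. Two distinct cells attack each other if they are in the same row, or if they are in adjacent rows and the one in the upper row is in a column strictly to the right of the one in the lower row. $T$ is non-attacking if $T(u)\ne T(v)$ for all attacking pairs $u,v$. $\mathrm{NAT}(\gamma)$ is the set of non-attacking fillings of $\mathrm{dg}(\mathrm{inc}(\gamma))$ whose bottom row, read left to right, is order-equivalent to $\beta(\gamma)$. For $T\in\mathrm{NAT}(\gamma)$, $$\mathrm{wt}(T)= q^{\mathrm{maj}(T)}t^{\mathrm{coinv}(T)} \prod_{\substack{u \in \widehat{\mathrm{dg}}(\gamma)\\ T(u) \neq T(\mathrm{South}(u))}} \frac{1-t}{1-q^{\mathrm{leg}(u)+1}t^{\mathrm{arm}(u)+1}}.$$ The quasisymmetric Macdonald polynomial is the formal power series in $X=\{x_1,x_2,\dots\}$ given by $G_\gamma(X;q,t)=\sum_{T\in\mathrm{NAT}(\gamma)}\mathrm{wt}(T)\,x^T$.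 Quasisymmetric Jack polynomial. With parameter $\alpha$, it is defined as the coefficientwise limit $$G_\gamma(X;\alpha)=\lim_{t\to1^-}\left(\prod_{u\in\mathrm{dg}(\lambda)}\frac{1-t^{\mathrm{arm}(u)+1}q^{\mathrm{leg}(u)}}{1-t}\right)G_\gamma(X;t^\alpha,t),\qquad q=t^\alpha,$$ where in the product $\mathrm{leg}(u)$ and $\mathrm{arm}(u)$ are computed in $\mathrm{dg}(\lambda)$. (The same prefactor turns the symmetric Macdonald polynomial $P_\lambda(X;t^\alpha,t)$ into the Jack polynomial $J_\lambda(X;\alpha)$ in the limit.) Standard fillings. $\mathrm{ST}(\gamma)$ is the set of fillings $\tau$ of $\mathrm{dg}(\mathrm{inc}(\gamma))$ using each of $1,\dots,n$ exactly once, whose bottom row, read left to right, is order-equivalent to $\beta(\gamma)$. For $\tau\in\mathrm{ST}(\gamma)$ cells are identified with their entries. Reading order reads rows from top to bottom and left to right within each row. $\mathrm{ID}(\tau)$ is the set of $i\in[n-1]$ such that $i+1$ precedes $i$ in reading order. $V(\tau)$ is the set of $i\in[n-1]$ such that $i\in\mathrm{ID}(\tau)$ or $i$ and $i+1$ are in cells attacking each other. $W(\tau)$ is the set of entries $i$ such that $i+1$ is in the cell directly below the cell of $i$. Fundamental quasisymmetric functions. For $S\subseteq[n-1]$, $F_S=\sum x_{i_1}x_{i_2}\cdots x_{i_n}$, the sum over all $1\le i_1\le i_2\le\cdots\le i_n$ such that $i_j\ne i_{j+1}$ whenever $j\in S$.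
   Formalization: The right-hand side is multiplied by the product of m_k!, m_k being the number of parts of gamma equal to k (as printed it fails for gamma=(1,1): 2e_2 versus e_2); alpha is real with no alpha(leg+1)+arm+1 equal to zero above the bottom row. *)

(* Defs.v *)
From HB Require Import structures.
From mathcomp Require Import all_boot all_order all_algebra all_fingroup.
From mathcomp Require Import finmap multiset.
From mathcomp Require Import all_classical all_reals all_analysis.
Set Implicit Arguments.
Unset Strict Implicit.
Unset Printing Implicit Defensive.
Import Order.TTheory GRing.Theory Num.Theory.
Import numFieldNormedType.Exports.
Local Open Scope classical_set_scope.
Local Open Scope ring_scope.

(** Formal power series in x_0, x_1, x_2, ...: a monomial is the finite multiset
    of the indices of its variables, and a series is the family of its
    coefficients.  The series below only involve x_1, x_2, ... *)

Definition series_of (R : nmodType) : Type := {mset nat}%mset -> R.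

(* The series sum_(i in A) w_i x^(mon i).  The sum defining a coefficient is
   finitely supported as soon as finitely many i in A have a given monomial. *)
Definition gen_series (R : nmodType) (I : choiceType) (A : set I)
    (w : I -> R) (mon : I -> {mset nat}%mset) : series_of R :=
  fun m => \sum_(i \in A `&` [set i | mon i = m]) w i.

(** Diagrams.  Rows (from the bottom) and columns (from the left) are numbered
    from 0, so the bottom row is row 0. *)

Definition cell (mu : seq nat) : finType :=
  {c : 'I_(size mu) & 'I_(nth 0%N mu c)}.

Section Diagram.
Variable mu : seq nat.
Implicit Types u v z : cell mu.

Definition col u : 'I_(size mu) := tag u.
Definition row u : nat := tagged u.
Definition height u : nat := nth 0%N mu (col u).

Definition above_bottom u : bool := (0 < row u)%N.

Lemma south_subproof u : ((row u).-1 < nth 0 mu (col u))%N.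
Proof. exact: leq_ltn_trans (leq_pred _) (ltn_ord (tagged u)). Qed.

(* On the bottom row, where there is no cell below, South is the identity. *)
Definition South u : cell mu :=
  Tagged (fun c : 'I_(size mu) => 'I_(nth 0%N mu c)) (Ordinal (south_subproof u)).

Definition leg u : nat := #|[pred v | (col v == col u) && (row u < row v)%N]|.

Definition arm_set u : {set cell mu} :=
  [set z | [&& row z == row u, (col u < col z)%N & (height z <= height u)%N]
        || [&& (row z).+1 == row u, (col z < col u)%N
             & (height z < height u)%N]].

Definition arm u : nat := #|arm_set u|.

Definition attacks u v : bool :=
  (u != v) && [|| row u == row v,
                  (row u == (row v).+1) && (col v < col u)%N
                | (row v == (row u).+1) && (col u < col v)%N].

Definition reads_before u v : bool :=
  (row v < row u)%N || ((row u == row v) && (col u < col v)%N).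

Implicit Type T : {ffun cell mu -> nat}.

Definition Des T : {set cell mu} :=
  [set u | above_bottom u && (T (South u) < T u)%N].

Definition maj T : nat := (\sum_(u in Des T) (leg u).+1)%N.

(* A triple (x, South x, z) is given by the pair (x, z). *)
Definition coinv_triple T x z : bool :=
  let y := South x in
  [&& above_bottom x, z \in arm_set x
    & [|| (T x < T z < T y)%N, (T z < T y < T x)%N | (T y < T x < T z)%N]].

Definition coinv T : nat := #|[pred p : cell mu * cell mu | coinv_triple T p.1 p.2]|.

Definition nonattacking T : Prop := forall u v, attacks u v -> T u <> T v.

Definition monomial T : {mset nat}%mset := seq_mset [seq T u | u : cell mu].

Definition weight (R : fieldType) (q t : R) T : R :=
  q ^+ maj T * t ^+ coinv T *
  \prod_(u | above_bottom u && (T u != T (South u)))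
     ((1 - t) / (1 - q ^+ (leg u).+1 * t ^+ (arm u).+1)).

End Diagram.

(** Compositions *)

Definition strong_composition (gamma : seq nat) : Prop :=
  forall k, k \in gamma -> (0 < k)%N.

Definition inc (gamma : seq nat) : seq nat := sort leq gamma.
Definition dec (gamma : seq nat) : seq nat := sort geq gamma.

Definition inversions l (s : 'S_l) : nat :=
  #|[pred p : 'I_l * 'I_l | (p.1 < p.2)%N && (s p.2 < s p.1)%N]|.

Definition sorts (gamma : seq nat) (s : 'S_(size gamma)) : bool :=
  [forall j, nth 0%N gamma (s j) == nth 0%N (inc gamma) j].
Arguments sorts : clear implicits.

Definition longest_sorting (gamma : seq nat) (s : 'S_(size gamma)) : bool :=
  sorts gamma s &&
  [forall s', sorts gamma s' ==> (inversions s' <= inversions s)%N].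
Arguments longest_sorting : clear implicits.

(* The default value is never used, see [betaP]. *)
Definition beta (gamma : seq nat) : 'S_(size gamma) :=
  odflt 1%g [pick s | longest_sorting gamma s].

Lemma betaP (gamma : seq nat) : longest_sorting gamma (beta gamma).
Proof.
rewrite /beta; case: pickP => //= none.
have [s0 s0P] : exists s : 'S_(size gamma), sorts gamma s.
  have /tuple_permP[s sE] : perm_eq (inc gamma) (in_tuple gamma).
    by rewrite perm_sort.
  exists s; apply/forallP => j; apply/eqP; rewrite sE.
  by rewrite -tnth_nth tnth_mktuple (tnth_nth 0%N).
case: (arg_maxnP (@inversions _) s0P) => s sP smax.
have := none s; rewrite /longest_sorting sP /=.
by move/negP; case; apply/forallP => s'; apply/implyP => /smax.
Qed.

Definition bottom_row_beta (gamma : seq nat)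
    (T : {ffun cell (inc gamma) -> nat}) : Prop :=
  let b u := beta gamma (cast_ord (size_sort leq gamma) (col u)) in
  forall u v, row u = 0%N -> row v = 0%N -> (T u < T v)%N = (b u < b v)%N.

(** Quasisymmetric Macdonald and Jack polynomials *)

Definition NAT (gamma : seq nat) : set {ffun cell (inc gamma) -> nat} :=
  [set T : {ffun cell (inc gamma) -> nat} |
    [/\ forall u, (0 < T u)%N, nonattacking T & bottom_row_beta T]].
Arguments NAT : clear implicits.

Definition qsMacdonald (R : fieldType) (gamma : seq nat) (q t : R) : series_of R :=
  gen_series (NAT gamma) (weight q t) (@monomial (inc gamma)).

(* In the limit t -> 1 with q = t `^ alpha, the top cells of the columns of
   dg(dec gamma) contribute the product of the m_k!, where m_k is the number of
   parts of gamma equal to k; the other factors match the cells above the bottom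
   row of dg(inc gamma).  The m_k! survive in the limit: they are what makes the
   Jack polynomial of (1, ..., 1) equal to n! e_n. *)
Definition jack_prefactor (R : fieldType) (gamma : seq nat) (q t : R) : R :=
  \prod_(u : cell (dec gamma)) ((1 - t ^+ (arm u).+1 * q ^+ leg u) / (1 - t)).

Definition jack_deformation (R : realType) (gamma : seq nat) (alpha t : R) :
    series_of R :=
  fun m => jack_prefactor gamma (t `^ alpha) t *
           qsMacdonald gamma (t `^ alpha) t m.

Definition qsJack (R : realType) (gamma : seq nat) (alpha : R) : series_of R :=
  fun m => lim (jack_deformation gamma alpha t m @[t --> 1^'-]).

(** Standard fillings.  A subset of {1, ..., n-1} is a {set 'I_n.-1}, the
    element i of 'I_n.-1 standing for the integer i.+1. *)

Definition ST (gamma : seq nat) : set {ffun cell (inc gamma) -> nat} :=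
  [set tau : {ffun cell (inc gamma) -> nat} |
    perm_eq [seq tau u | u : cell (inc gamma)] (iota 1 (sumn gamma))
    /\ bottom_row_beta tau].
Arguments ST : clear implicits.

Section StandardFilling.
Variables (mu : seq nat) (n : nat) (tau : {ffun cell mu -> nat}).

Definition ID_set : {set 'I_n.-1} :=
  [set i : 'I_n.-1 | [exists u, exists v,
     [&& tau u == i.+1, tau v == i.+2 & reads_before v u]]].

Definition V_set : {set 'I_n.-1} :=
  [set i : 'I_n.-1 | (i \in ID_set) || [exists u, exists v,
     [&& tau u == i.+1, tau v == i.+2 & attacks u v]]].

Definition W_cells : {set cell mu} :=
  [set u | above_bottom u && (tau (South u) == (tau u).+1)].

Definition entries (U : {set cell mu}) : {set 'I_n.-1} :=
  [set i : 'I_n.-1 | [exists u in U, tau u == i.+1]].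

End StandardFilling.

(* Here nth 0 i k is the index i_(k+1), and k \in S stands for k.+1 in S. *)
Definition fundamental (R : pzSemiRingType) (n : nat) (S : {set 'I_n.-1}) :
    series_of R :=
  gen_series
    [set i : n.-tuple nat |
      [/\ forall k, k \in i -> (0 < k)%N,
          sorted leq i
        & forall k : 'I_n.-1, k \in S -> nth 0%N i k <> nth 0%N i k.+1]]
    (fun=> 1) (fun i => seq_mset i).

(* This expansion does not contain the m_k! of [jack_prefactor]; for example for
   gamma = (1, 1) it is e_2, whereas [qsJack] is 2 e_2. *)
Definition jack_expansion (R : fieldType) (gamma : seq nat) (alpha : R) :
    series_of R :=
  let n := sumn gamma in
  let c (u : cell (inc gamma)) : R := alpha * (leg u).+1%:R + (arm u)%:R in
  fun m =>
  \sum_(tau \in ST gamma)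
    (\prod_(u in W_cells tau) (c u + 1)) *
    \sum_(U : {set cell (inc gamma)} | U \subset W_cells tau)
       (-1) ^+ #|U| * (\prod_(u in U) (c u / (c u + 1))) *
       fundamental R (V_set n tau :|: entries n tau U) m.

(* Main.v *)
From Pilot Require Import Defs.
From mathcomp Require Import all_boot all_order all_algebra all_fingroup.
From mathcomp Require Import finmap multiset.
From mathcomp Require Import all_classical all_reals all_analysis.
From mathcomp Require Import zify.
Import Order.TTheory GRing.Theory Num.Theory.
Import numFieldNormedType.Exports.
Local Open Scope classical_set_scope.
Local Open Scope ring_scope.

(* [row] and [col] are otherwise those of matrix.v. *)
Import Pilot.Defs.

Set Implicit Arguments.
Unset Strict Implicit.
Unset Printing Implicit Defensive.

(** Write q = t^alpha and c u = alpha (leg u + 1) + arm u.  The cells of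
    dg(dec gamma) below the top of their column match the cells of
    dg(inc gamma) above the bottom row, with the same arm and with a leg
    longer by one, so the prefactor cancels the denominators of wt(T).  What remains
    is the t-analogue of the product of the m_k!, a power of t, and one factor
    (1 - t^(c u + 1)) / (1 - t) for each cell u with T(u) = T(South u); hence
    in the limit T counts for the product of the m_k! times the product of the
    c u + 1 over these cells.

    On the other side, let s be the sorted list of the indices of the monomial
    m.  Then F_S contains m exactly when S avoids the ties s_i = s_(i+1), and
    the sum over U is the expansion of a product over W(tau): it leaves the
    product of the c u + 1 over the u in W(tau) sitting at a tie.  The two sums
    agree through the bijection T = (nth s) o tau: tau standardizes T, equal
    entries being numbered in reading order, and V(tau) avoids the ties exactly
    when T is non-attacking. *)

(** * Standardization *)

Lemma card_cell (mu : seq nat) : #|cell mu| = sumn mu.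
Proof.
rewrite card_tagged sumnE big_map big_enum /= sumnE (big_nth 0%N) big_mkord.
by apply: eq_bigr => i _; rewrite card_ord.
Qed.

Section Standardization.
Variables (mu : seq nat) (n : nat) (s : seq nat).
Hypotheses (size_s : size s = n) (sorted_s : sorted leq s).
Implicit Types (tau T : {ffun cell mu -> nat}) (u v w : cell mu).

Definition tie_free (S : {set 'I_n.-1}) : bool :=
  [forall i in S, nth 0%N s i != nth 0%N s i.+1].

Definition standard tau : bool := perm_eq [seq tau u | u : cell mu] (iota 1 n).

(** Entries start at 1 and positions in [s] at 0, hence the predecessor. *)
Definition relabel tau : {ffun cell mu -> nat} :=
  [ffun u => nth 0%N s (tau u).-1].

Lemma standard_range tau u : standard tau -> (0 < tau u <= n)%N.
Proof.
move=> /perm_mem/(_ (tau u)); rewrite mem_iota => <-.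
by apply/mapP; exists u; rewrite ?mem_enum.
Qed.

Lemma standard_inj tau : standard tau -> injective tau.
Proof.
move=> tauP; apply/injectiveP; rewrite /injectiveb /dinjectiveb.
by rewrite (perm_uniq tauP) iota_uniq.
Qed.

Lemma standard_surj tau k :
  standard tau -> (0 < k <= n)%N -> exists u, tau u = k.
Proof.
move=> /perm_mem/(_ k); rewrite mem_iota => <- /mapP[u _ ->].
by exists u.
Qed.

Lemma nth_sorted i j : (i <= j < n)%N -> (nth 0%N s i <= nth 0%N s j)%N.
Proof.
move=> /andP[ij jn]; apply: (sorted_leq_nth leq_trans leqnn) => //.
- by rewrite inE size_s (leq_ltn_trans ij).
- by rewrite inE size_s.
Qed.

Lemma relabel_homo tau u v :
  standard tau -> (tau u <= tau v)%N -> (relabel tau u <= relabel tau v)%N.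
Proof.
move=> tauP uv; rewrite !ffunE; apply: nth_sorted.
by have := standard_range u tauP; have := standard_range v tauP; lia.
Qed.

(** Equal labels make [tau u] a tie, so it lies outside V(tau): [v] is not read before [u] and does
    not attack it, which leaves only a strictly lower row. *)
Lemma relabel_step tau u v :
    standard tau -> tie_free (V_set n tau) ->
    relabel tau u = relabel tau v -> tau v = (tau u).+1 ->
  (row v < row u)%N /\ ~~ attacks u v.
Proof.
move=> tauP VE; rewrite !ffunE => Tuv uv.
have := standard_range u tauP; have := standard_range v tauP => vr ur.
have lt_i : ((tau u).-1 < n.-1)%N by lia.
pose i := Ordinal lt_i.
have iu : tau u = i.+1 by rewrite /= prednK //; case/andP: ur.
have iv : tau v = i.+2 by rewrite uv iu.
have iE : nth 0%N s i == nth 0%N s i.+1 by rewrite -[i.+1]/(i.+2.-1) -iv -Tuv.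
have : i \notin V_set n tau by apply: contraL iE => /(forall_inP VE).
rewrite inE negb_or => /andP[].
rewrite inE => /existsPn/(_ u)/existsPn/(_ v).
rewrite -iv -iu !eqxx /= => NR /existsPn/(_ u)/existsPn/(_ v).
rewrite !eqxx /= => NA; split=> //.
have neq_uv : u != v by apply/eqP => e; move: uv; rewrite e; lia.
move: NA NR; rewrite /attacks /reads_before neq_uv /=; lia.
Qed.

(* A block of equal entries meets each row at most once and goes down, so that
   an attack inside it can only involve two consecutive entries of tau. *)
Lemma relabel_tie tau u v :
    standard tau -> tie_free (V_set n tau) ->
    relabel tau u = relabel tau v -> (tau u < tau v)%N ->
  (row v < row u)%N /\ (tau v = (tau u).+1 \/ ((row v).+1 < row u)%N).
Proof.
move=> tauP VE.
have [d] := ubnP (tau v - tau u)%N; elim: d u => // d IH u dP Tuv uv.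
have [e|ne] := eqVneq (tau v) (tau u).+1.
  by have [] := relabel_step tauP VE Tuv e; split=> //; left.
have [w wE] : exists w, tau w = (tau u).+1.
  by apply: standard_surj => //; have := standard_range v tauP; lia.
have Tuw : relabel tau u = relabel tau w.
  apply/eqP; rewrite eqn_leq relabel_homo ?wE //=.
  by rewrite Tuv relabel_homo // wE; lia.
have [wu _] := relabel_step tauP VE Tuw wE.
have [|||vw _] := IH w; rewrite ?wE; [lia|by rewrite -Tuw|lia|].
by split; [lia|right; lia].
Qed.

(** Cells with equal labels carry consecutive entries, where [relabel_step] excludes an attack, or
    lie at least two rows apart. *)
Lemma relabel_nonattacking tau :
    standard tau -> tie_free (V_set n tau) ->
  nonattacking (relabel tau).
Proof.
move=> tauP VE.
have lt_case u v : relabel tau u = relabel tau v -> (tau u < tau v)%N ->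
    ~~ attacks u v.
  move=> Tuv uv; have [r [e|r']] := relabel_tie tauP VE Tuv uv.
    by have [] := relabel_step tauP VE Tuv e.
  by rewrite /attacks; lia.
move=> u v auv Tuv; have [uv|uv|/(standard_inj tauP) e] := ltngtP (tau u) (tau v).
- by have := lt_case u v Tuv uv; rewrite auv.
- have := lt_case v u (esym Tuv) uv; apply/negP/negPn.
  by move: auv; rewrite /attacks (eq_sym v); lia.
- by move: auv; rewrite /attacks e eqxx.
Qed.

(** Labels and rows alone determine the order of the entries, hence, through ranks, the filling
    [tau]: this gives injectivity. *)
Lemma relabel_lt tau u v :
    standard tau -> tie_free (V_set n tau) ->
  (tau u < tau v)%N = (relabel tau u < relabel tau v)%N ||
    ((relabel tau u == relabel tau v) && (row v < row u)%N).
Proof.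
move=> tauP VE.
have tie u' v' : relabel tau u' = relabel tau v' -> (tau u' < tau v')%N ->
    (row v' < row u')%N.
  by move=> e l; have [] := relabel_tie tauP VE e l.
have [uv|uv|/(standard_inj tauP) ->] := ltngtP (tau u) (tau v); last by lia.
- have := relabel_homo tauP (ltnW uv); rewrite leq_eqVlt => /orP[/eqP e|->//].
  by rewrite e ltnn eqxx (tie u v).
- have := relabel_homo tauP (ltnW uv); rewrite leq_eqVlt => /orP[/eqP e|]; last lia.
  by rewrite e ltnn eqxx; have := tie v u e uv; lia.
Qed.

Lemma count_leq_iota k m : (k <= m)%N -> count (leq^~ k) (iota 1 m) = k.
Proof.
move=> km; rewrite -(subnKC km) iotaD count_cat.
have /eqP -> : count (leq^~ k) (iota 1 k) == size (iota 1 k).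
  by rewrite -all_count; apply/allP => i; rewrite mem_iota; lia.
rewrite size_iota (@eq_in_count _ _ pred0) ?count_pred0 ?addn0 // => i.
by rewrite mem_iota /=; lia.
Qed.

Lemma standard_rank tau u :
  standard tau -> tau u = #|[pred v | (tau v <= tau u)%N]|.
Proof.
move=> tauP; have /andP[_ ur] := standard_range u tauP.
rewrite -[LHS](count_leq_iota ur) -(seq.permP tauP) count_map.
by rewrite cardE -size_filter enumT.
Qed.

Lemma relabel_injective tau tau' :
    standard tau -> standard tau' ->
    tie_free (V_set n tau) -> tie_free (V_set n tau') ->
  relabel tau = relabel tau' -> tau = tau'.
Proof.
move=> tauP tauP' VE VE' e; apply/ffunP => u.
rewrite (standard_rank u tauP) (standard_rank u tauP'); apply: eq_card => v.
rewrite !inE leqNgt [RHS]leqNgt (relabel_lt _ _ tauP VE).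
by rewrite (relabel_lt _ _ tauP' VE') e.
Qed.

(** As [u] and [South u] are in adjacent rows, [relabel_tie] leaves only consecutive entries, the
    larger one below. *)
Lemma relabel_South tau u :
    standard tau -> tie_free (V_set n tau) -> above_bottom u ->
  (relabel tau u == relabel tau (South u)) =
    (tau (South u) == (tau u).+1) &&
    (nth 0%N s (tau u).-1 == nth 0%N s (tau u)).
Proof.
move=> tauP VE u0; apply/eqP/andP => [Tu|[/eqP e /eqP se]]; last first.
  by rewrite !ffunE e.
have rS : (row (South u)).+1 = row u by rewrite /= prednK.
suff e : tau (South u) = (tau u).+1.
  by split; move: Tu; rewrite ?e // !ffunE e => ->.
have [uv|uv|/(standard_inj tauP) e] := ltngtP (tau u) (tau (South u)).
- by have [_ []] := relabel_tie tauP VE Tu uv; first by []; rewrite rS ltnn.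
- by have [] := relabel_tie tauP VE (esym Tu) uv; rewrite -rS ltnNge leqnSn.
- by move: rS; rewrite -e; lia.
Qed.

(** [tau] numbers the cells by label, equal labels from top to bottom; no two equal labels share a
    row, as [T] is non-attacking. *)
Lemma relabel_surj T :
    perm_eq [seq T u | u : cell mu] s -> nonattacking T ->
  exists tau, [/\ standard tau, tie_free (V_set n tau) & relabel tau = T].
Proof.
move=> Ts NA.
pose le u v := (T u < T v)%N || ((T u == T v) && (row v <= row u)%N).
have le_total : total le by move=> u v; rewrite /le; lia.
have le_trans : transitive le by move=> u v w; rewrite /le; lia.
pose L := sort le (enum (cell mu)).
have permL : perm_eq L (enum (cell mu)) by rewrite perm_sort.
have memL u : u \in L by rewrite (perm_mem permL) mem_enum.
have uniqL : uniq L by rewrite (perm_uniq permL) enum_uniq.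
have mapL : map T L = s.
  apply: (sorted_eq leq_trans anti_leq) => //.
    apply: (homo_sorted (e := le)); last exact: sort_sorted.
    by move=> u v; rewrite /le; lia.
  exact: perm_trans (perm_map T permL) Ts.
have sizeL : size L = n by rewrite -size_s -mapL size_map.
pose tau : {ffun cell mu -> nat} := [ffun u => (index u L).+1].
have relabel_tau : relabel tau = T.
  apply/ffunP => u; rewrite !ffunE /= -mapL.
  by rewrite (nth_map u) ?index_mem // nth_index.
have standard_tau : standard tau.
  apply: (@perm_trans _ (map tau L)); first by rewrite perm_sym perm_map.
  rewrite (_ : map tau L = iota 1 n) //.
  apply: (@eq_from_nth _ 0%N) => [|i]; rewrite size_map ?size_iota ?sizeL // => iL.
  have [u0 _] : exists u, u \in L.
    by case: (L) sizeL => [/= e|u ? _]; [lia|exists u; rewrite inE eqxx].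
  by rewrite (nth_map u0) ?sizeL // nth_iota // ffunE index_uniq ?sizeL.
(* An element [i] of V(tau) at a tie gives two successive cells [u], [v] of [L] with equal labels.
   The sorting puts [v] no higher than [u], and the absence of attacks puts it strictly lower,
   against the choice of [i]. *)
exists tau; split=> //; apply/forall_inP => i iV; apply/negP => /eqP si.
have [u [v [iu iv D]]] : exists u v,
    [/\ tau u = i.+1, tau v = i.+2 & reads_before v u || attacks u v].
  move: iV; rewrite !inE => /orP[] /existsP[u /existsP[v /and3P[/eqP iu /eqP iv D]]];
  by exists u, v; split=> //; rewrite D ?orbT.
have Tuv : T u = T v by rewrite -relabel_tau [LHS]ffunE [RHS]ffunE iu iv.
have le_uv : le u v.
  have := sort_sorted le_total (enum (cell mu)); rewrite -/L => sortL.
  have := standard_range v standard_tau; rewrite iv => iLt.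
  have := sorted_ltn_nth le_trans u sortL.
  move=> /(_ i i.+1); rewrite !inE sizeL => /(_ _ _ (ltnSn i)).
  have -> : nth u L i = u by move: iu; rewrite ffunE => -[<-]; rewrite nth_index.
  have -> : nth u L i.+1 = v by move: iv; rewrite ffunE => -[<-]; rewrite nth_index.
  by apply; lia.
have NAuv : ~~ attacks u v by apply/negP => /NA; rewrite Tuv.
have neq_uv : u != v by apply/eqP => e; move: iv; rewrite -e iu; lia.
move: D le_uv NAuv; rewrite /le /reads_before /attacks neq_uv Tuv ltnn eqxx /=.
lia.
Qed.
End Standardization.

(** * The fundamental expansion *)

(** At a cell of [W] satisfying [P] the factor is (c + 1)(1 - c / (c + 1)) = 1, at the other cells
    of [W] it is c + 1; distributing this product yields the sum over [U]. *)
Lemma prod_sum_subsets (R : fieldType) (I : finType) (W : {set I}) (P : pred I)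
    (c : I -> R) :
    (forall u, u \in W -> c u + 1 != 0) ->
  (\prod_(u in W) (c u + 1)) *
    (\sum_(U : {set I} | U \subset W)
       (-1) ^+ #|U| * (\prod_(u in U) (c u / (c u + 1))) *
       ([forall u in U, P u])%:R) =
  \prod_(u in W | ~~ P u) (c u + 1).
Proof.
move=> c1.
(* As [F] vanishes elsewhere, only subsets of the cells of [W] satisfying [P] survive in the
   expansion over all cells. *)
pose F u := if (u \in W) && P u then - (c u / (c u + 1)) else 0.
have -> : \sum_(U : {set I} | U \subset W)
       (-1) ^+ #|U| * (\prod_(u in U) (c u / (c u + 1))) *
       ([forall u in U, P u])%:R = \prod_u (F u + 1).
  rewrite bigA_distr big_mkcond /=; apply: eq_bigr => U _.
  rewrite -big_mkcond /=.
  have [/andP[/fintype.subsetP UW /forall_inP UP]|] :=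
      boolP ((U \subset W) && [forall u in U, P u]).
    rewrite ifT; last exact/fintype.subsetP.
    have -> : [forall u in U, P u] by exact/forall_inP.
    rewrite mulr1 -prodrN; apply: eq_bigr => u uU.
    by rewrite /F UW ?UP.
  move=> H; transitivity (0 : R).
    move: H; rewrite negb_and; case: ifP => //= _ /negPf ->.
    by rewrite mulr0.
  have [u uU uN] : exists2 u, u \in U & ~~ ((u \in W) && P u).
    move: H; rewrite negb_and => /orP[/fintype.subsetPn[u uU uW]|/forall_inPn[u uU uP]];
      exists u => //; first by rewrite (negPf uW).
    by rewrite (negPf uP) andbF.
  by rewrite (bigD1 u) //= /F (negPf uN) mul0r.
rewrite [in LHS]big_mkcond -big_split big_mkcondl /= [RHS]big_mkcond /=.
apply: eq_bigr => u _; rewrite /F; case: (boolP (u \in W)) => [uW|_] /=.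
  case: (P u) => /=; last by rewrite add0r mulr1.
  by rewrite mulrDr mulr1 mulrN [X in - X]mulrC divfK ?c1 // addKr.
by rewrite add0r mulr1 if_same.
Qed.

Lemma tie_freeU n s (A B : {set 'I_n.-1}) :
  tie_free s (A :|: B) = tie_free s A && tie_free s B.
Proof.
apply/forall_inP/andP => [AB|[/forall_inP A' /forall_inP B'] i].
  by split; apply/forall_inP => i iA; apply: AB; rewrite inE iA ?orbT.
by rewrite inE => /orP[/A'|/B'].
Qed.

(** Below a cell [u] of W(tau) stands tau u + 1, so [tau u] is at most n - 1 and does index an
    element of ['I_n.-1]. *)
Lemma tie_free_entries (mu : seq nat) n s (tau : {ffun cell mu -> nat})
    (U : {set cell mu}) :
    standard n tau -> U \subset W_cells tau ->
  tie_free s (entries n tau U) =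
  [forall u in U, nth 0%N s (tau u).-1 != nth 0%N s (tau u)].
Proof.
move=> tauP /fintype.subsetP UW; apply/forall_inP/forall_inP => [H u uU|H i].
  have := UW u uU; rewrite inE => /andP[_ /eqP uS].
  have := standard_range u tauP; have := standard_range (South u) tauP => rS ru.
  have lt_i : ((tau u).-1 < n.-1)%N by lia.
  have /= := H (Ordinal lt_i); rewrite prednK; last by case/andP: ru.
  apply; rewrite inE; apply/exists_inP; exists u => //=.
  by rewrite prednK //; case/andP: ru.
by rewrite inE => /exists_inP[u uU /eqP ui]; have := H u uU; rewrite ui.
Qed.

(** A monomial has a single weakly increasing list of indices, so its coefficient is 0 or 1. *)
Lemma fundamental_seq_mset (R : pzSemiRingType) n (S : {set 'I_n.-1}) s :
    sorted leq s ->
  fundamental R S (seq_mset s) =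
    [&& size s == n, all (ltn 0) s & tie_free s S]%:R.
Proof.
move=> sorted_s; rewrite /fundamental /gen_series.
set D := (X in \sum_(_ \in X) _).
have D_eq i : D i -> tval i = s.
  move=> [[_ i_sorted _] /eq_seq_msetP i_s].
  exact: (sorted_eq leq_trans anti_leq).
case: and3P => [[sz /allP s_pos /forall_inP sS]|nb].
  have -> : D = [set Tuple sz].
    apply/seteqP; split=> [i /D_eq i_s|_ ->]; first exact: val_inj.
    by split=> //; split=> // k /sS/eqP.
  by rewrite fsbig_set1.
apply: fsbig1 => i Di; case: nb; move: (Di) => [[i_pos _ i_S] _].
rewrite -(D_eq i Di) size_tuple; split=> //; first exact/allP.
by apply/forall_inP => k /i_S/eqP.
Qed.

(** * Bijection between standard and non-attacking fillings *)

Section Reindexing.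
Variables (gamma : seq nat) (s : seq nat).
Hypotheses (size_s : size s = sumn gamma) (sorted_s : sorted leq s).
Hypothesis pos_s : all (ltn 0) s.
Let n := sumn gamma.

Lemma relabel_bottom_row (tau : {ffun cell (inc gamma) -> nat}) :
    standard n tau -> tie_free s (V_set n tau) ->
  bottom_row_beta (relabel s tau) <-> bottom_row_beta tau.
Proof.
move=> tauP VE.
have lt_eq u v : row u = 0%N -> row v = 0%N ->
    (relabel s tau u < relabel s tau v)%N = (tau u < tau v)%N.
  move=> u0 v0; rewrite (relabel_lt size_s sorted_s _ _ tauP VE) u0 v0.
  by rewrite ltnn andbF orbF.
by split=> H b u v u0 v0; [rewrite -lt_eq //|rewrite lt_eq //]; exact: H.
Qed.

Lemma perm_relabel (mu : seq nat) (tau : {ffun cell mu -> nat}) :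
  standard n tau -> perm_eq [seq relabel s tau u | u : cell mu] s.
Proof.
move=> tauP.
have -> : [seq relabel s tau u | u : cell mu] =
    [seq nth 0%N s k.-1 | k <- [seq tau u | u : cell mu]].
  by rewrite -map_comp; apply: eq_map => u /=; rewrite ffunE.
apply: (perm_trans (perm_map _ tauP)).
rewrite (_ : map _ _ = s) //; apply: (@eq_from_nth _ 0%N) => [|i].
  by rewrite size_map size_iota size_s.
rewrite size_map size_iota => i_n.
by rewrite (nth_map 0%N) ?size_iota // nth_iota.
Qed.

Lemma relabel_bij :
  set_bij [set tau | ST gamma tau /\ tie_free s (V_set n tau)]
    (NAT gamma `&` [set T | monomial T = seq_mset s]) (relabel s).
Proof.
split=> [tau [[tauP tau_b] VE]|tau tau'|T [[T_pos T_NA T_b] /eq_seq_msetP Ts]].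
- split; last exact/eq_seq_msetP/perm_relabel.
  split; last exact/(relabel_bottom_row tauP VE);
    last exact: (relabel_nonattacking size_s sorted_s tauP VE).
  move=> u; rewrite ffunE; apply: (allP pos_s); apply: mem_nth.
  by have := standard_range u tauP; rewrite size_s; lia.
- rewrite !inE => -[[tauP _] VE] [[tauP' _] VE'].
  exact: (relabel_injective size_s sorted_s tauP tauP').
- have [tau [tauP VE tauT]] := relabel_surj size_s sorted_s Ts T_NA.
  exists tau => //; split=> //; split=> //.
  by apply/(relabel_bottom_row tauP VE); rewrite tauT.
Qed.
End Reindexing.

Lemma jack_expansion_seq_mset (R : fieldType) (gamma : seq nat) (alpha : R) s :
    let c (u : cell (inc gamma)) := alpha * (leg u).+1%:R + (arm u)%:R in
    (forall u, above_bottom u -> c u + 1 != 0) -> sorted leq s ->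
  jack_expansion gamma alpha (seq_mset s) =
  \sum_(T \in NAT gamma `&` [set T | monomial T = seq_mset s])
    \prod_(u | above_bottom u && (T u == T (South u))) (c u + 1).
Proof.
move=> c c1 sorted_s; rewrite /jack_expansion -/c.
set n := sumn gamma.
have [/andP[/eqP size_s pos_s]|bad] :=
    boolP ((size s == n) && all (ltn 0) s); last first.
  (* With a wrong degree or an index 0, the monomial occurs in no filling and in no fundamental
     function: both sides vanish. *)
  rewrite !fsbig1 // => [T [[T_pos _ _] /eq_seq_msetP Ts]|tau _].
    case/negP: bad; rewrite -(perm_size Ts) -(perm_all _ Ts).
    rewrite size_map -cardE card_cell (perm_sumn (_ : perm_eq _ gamma)) ?perm_sort //.
    by rewrite eqxx; apply/allP => _ /mapP[u _ ->]; exact: T_pos.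
  rewrite [X in _ * X]big1 ?mulr0 // => U _; rewrite fundamental_seq_mset // andbA.
  by rewrite (negPf bad) mulr0.
rewrite (reindex_fsbig (relabel s) _ _ _ (relabel_bij size_s sorted_s pos_s)).
rewrite -[X in _ = \sum_(_ \in X) _]/(ST gamma `&` [set tau | tie_free s (V_set n tau)]).
(* If V(tau) meets a tie, every F in the inner sum misses the monomial; the other fillings are
   matched term by term. *)
rewrite [RHS]fsbig_mkcondr; apply: eq_fsbigr => tau /set_mem[tauP _].
case: ifPn => [/set_mem /= VE|/negP VE]; last first.
  rewrite [X in _ * X]big1 ?mulr0 // => U _; rewrite fundamental_seq_mset // tie_freeU.
  case: (boolP (tie_free _ _)) => [V|_]; first by case: VE; rewrite inE.
  by rewrite !andbF mulr0.
pose P u := nth 0%N s (tau u).-1 != nth 0%N s (tau u).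
transitivity (\prod_(u in W_cells tau | ~~ P u) (c u + 1)); last first.
  apply: eq_bigl => u; rewrite inE -andbA /P negbK.
  case: (boolP (above_bottom u)) => //= u0.
  by rewrite (relabel_South size_s sorted_s tauP VE u0).
rewrite -prod_sum_subsets; last by move=> u; rewrite inE => /andP[/c1].
congr (_ * _); apply: eq_bigr => U UW; rewrite fundamental_seq_mset //.
by rewrite size_s eqxx pos_s tie_freeU VE (tie_free_entries _ tauP).
Qed.

(** * Cancellation of the prefactor *)

Lemma big_cell (R : Type) (idx : R) (op : Monoid.com_law idx) (mu : seq nat)
    (P : 'I_(size mu) -> pred nat) (F : 'I_(size mu) -> nat -> R) :
  \big[op/idx]_(u : cell mu | P (col u) (row u)) F (col u) (row u) =
  \big[op/idx]_(c < size mu) \big[op/idx]_(r < nth 0%N mu c | P c r) F c r.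
Proof. by rewrite sig_big_dep. Qed.

Lemma card_cell_pred (mu : seq nat) (P : 'I_(size mu) -> pred nat) :
  #|[pred u : cell mu | P (col u) (row u)]| =
  (\sum_(c < size mu) \sum_(r < nth 0 mu c | P c r) 1)%N.
Proof. by rewrite -sum1_card (big_cell _ P (fun _ _ => 1%N)). Qed.

Lemma sum_ord_eq n k (b : bool) :
  (\sum_(r < n | (r == k :> nat) && b) 1 = (k < n) && b)%N.
Proof.
have [kn|nk] := ltnP k n; last by rewrite big_pred0 // => r; have := ltn_ord r; lia.
case: b; last by rewrite big_pred0 // => r; rewrite andbF.
by rewrite (big_pred1 (Ordinal kn)) // => r; rewrite andbT.
Qed.

Lemma sum_ord_count (s : seq nat) (a : pred nat) c :
  (\sum_(i < size s) ((c <= i) && a (nth 0 s i)) = count a (drop c s))%N.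
Proof.
elim: s c => [|x s IH] [|c] //=; rewrite ?big_ord0 // big_ord_recl /=.
  by congr (_ + _)%N; have := IH 0%N; rewrite drop0 => <-; apply: eq_bigr.
by rewrite -IH add0n; apply: eq_bigr.
Qed.

Lemma legE (mu : seq nat) (u : cell mu) : leg u = (height u - (row u).+1)%N.
Proof.
rewrite /leg (card_cell_pred (fun c r => (c == col u) && (row u < r)%N)).
rewrite (bigD1 (col u)) //= [X in (_ + X)%N]big1 ?addn0; last first.
  by move=> c /negPf ne; rewrite big_pred0 // => r; rewrite ne.
rewrite eqxx /= -/(height u); set k := row u; set h := height u.
transitivity (\sum_(k.+1 <= r < h) 1)%N; last by rewrite sum_nat_const_nat muln1.
by rewrite (big_nat_widenl _ 0%N) // big_mkord.
Qed.

(** Each column meets the arm at most once: in the row of [u] on its right, in the row below on its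
    left. The test [0 < row u] guards against [(row u).-1] being 0 on the bottom row. *)
Lemma armE (mu : seq nat) (u : cell mu) :
  (arm u = \sum_(c < size mu)
     ([&& col u < c, nth 0 mu c <= height u & row u < nth 0 mu c] +
      [&& c < col u, nth 0 mu c < height u, 0 < row u &
          (row u).-1 < nth 0 mu c]))%N.
Proof.
rewrite /arm /arm_set cardsE.
rewrite (card_cell_pred (fun c r =>
  [&& r == row u, (col u < c)%N & (nth 0 mu c <= height u)%N] ||
  [&& r.+1 == row u, (c < col u)%N & (nth 0 mu c < height u)%N])).
apply: eq_bigr => c _.
have [/= cu|/= uc] := ltnP c (col u).
  rewrite ltnNge (ltnW cu) /= add0n.
  rewrite (eq_bigl (fun r : 'I__ => (r == (row u).-1 :> nat) &&
      ((nth 0 mu c < height u) && (0 < row u)))%N).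
    by rewrite sum_ord_eq; lia.
  by move=> r; lia.
rewrite (eq_bigl (fun r : 'I__ => (r == row u :> nat) &&
    ((col u < c) && (nth 0 mu c <= height u)))%N).
  by rewrite sum_ord_eq; lia.
by move=> r; lia.
Qed.

(* In both diagrams the arm of a cell is e + N, where e counts the columns of the
   same height to its right and N the shorter columns reaching a given row.
   N only depends on the multiset of heights, and so does the multiset of the
   pairs (height, e). *)
Definition later_equals (mu : seq nat) c := count_mem (nth 0%N mu c) (drop c.+1 mu).
Definition between (mu : seq nat) k r := count (fun j => (j < k) && (r < j))%N mu.

Lemma arm_sum (mu : seq nat) (u : cell mu) r :
    (forall c : 'I_(size mu),
      [&& col u < c, nth 0 mu c <= height u & row u < nth 0 mu c] +
      [&& c < col u, nth 0 mu c < height u, 0 < row u &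
          (row u).-1 < nth 0 mu c] =
      ((col u < c) && (nth 0 mu c == height u)) +
      ((0 <= c) && ((nth 0 mu c < height u) && (r < nth 0 mu c))))%N ->
  arm u = (later_equals mu (col u) + between mu (height u) r)%N.
Proof.
move=> H; rewrite armE (eq_bigr _ (fun c _ => H c)) big_split /=.
rewrite (sum_ord_count _ (pred1 (height u))).
by rewrite (sum_ord_count mu (fun j => (j < height u) && (r < j))%N 0) drop0.
Qed.

(** Shorter columns all lie to the right, where they count in the row of [u]; columns to the left
    are at least as high and contribute nothing. *)
Lemma arm_dec (gamma : seq nat) (u : cell (dec gamma)) :
  arm u = (later_equals (dec gamma) (col u) +
           between (dec gamma) (height u) (row u))%N.
Proof.
apply: arm_sum => c.
have mono (i j : 'I_(size (dec gamma))) :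
    (i <= j -> nth 0 (dec gamma) j <= nth 0 (dec gamma) i)%N.
  move=> ij; apply: (sorted_leq_nth (leT := geq)) => //.
  - by move=> ? ? ? h1 h2; apply: leq_trans h2 h1.
  - by move=> x; apply: leqnn.
  - by apply: sort_sorted => x y; rewrite /geq /= leq_total.
  - by rewrite inE.
  - by rewrite inE.
have := mono c (col u); have := mono (col u) c; have := ltn_ord (tagged u).
by rewrite -/(row u) -/(col u) -/(height u); lia.
Qed.

(** Shorter columns all lie to the left, where they count in the row below [u]; to the right only
    equal heights count. *)
Lemma arm_inc (gamma : seq nat) (u : cell (inc gamma)) : above_bottom u ->
  arm u = (later_equals (inc gamma) (col u) +
           between (inc gamma) (height u) (row u).-1)%N.
Proof.
rewrite /above_bottom => u0; apply: arm_sum => c.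
have mono (i j : 'I_(size (inc gamma))) :
    (i <= j -> nth 0 (inc gamma) i <= nth 0 (inc gamma) j)%N.
  move=> ij; apply: (sorted_leq_nth leq_trans leqnn) => //; rewrite ?inE //.
  exact/sort_sorted/leq_total.
have := mono c (col u); have := mono (col u) c; have := ltn_ord (tagged u).
by rewrite -/(row u) -/(col u) -/(height u); lia.
Qed.

(** From right to left, the columns of a given height have 0, 1, 2, ... equal columns after them.
    The induction adds a first column, whose value is the largest for its height. *)
Lemma prod_later_equals (R : comNzRingType) (U mu : seq nat) (F : nat -> nat -> R) :
    uniq U -> {subset mu <= U} ->
  \prod_(c < size mu) F (nth 0%N mu c) (later_equals mu c) =
  \prod_(k <- U) \prod_(e < count_mem k mu) F k e.
Proof.
move=> uU; elim: mu => [|x mu IH] sub; rewrite /= ?big_ord0.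
  by rewrite big1 // => k _; rewrite big_ord0.
rewrite big_ord_recl /=.
rewrite [X in _ * X](_ : _ = \prod_(k <- U) \prod_(e < count_mem k mu) F k e).
  have xU : x \in U by apply: sub; rewrite inE eqxx.
  rewrite !(bigD1_seq x) //= eqxx add1n big_ord_recr /= [in RHS]mulrAC mulrC.
  rewrite /later_equals /= drop0; congr (_ * _ * _).
  by apply: eq_bigr => k /negPf; rewrite eq_sym => ->.
by rewrite -IH // => k kmu; apply: sub; rewrite inE kmu orbT.
Qed.

(** Row r of a column of dg(dec gamma) is matched with row r + 1 of the column of dg(inc gamma)
    having the same height and the same [e]. The column tops of dg(dec gamma) remain, with leg 0 and
    arm [e]. *)
Lemma prod_dec_inc (R : comNzRingType) (gamma : seq nat) (f : nat -> nat -> R) :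
    strong_composition gamma ->
  \prod_(u : cell (dec gamma)) f (arm u) (leg u) =
  (\prod_(k <- undup gamma) \prod_(e < count_mem k gamma) f e 0%N) *
  \prod_(u : cell (inc gamma) | above_bottom u) f (arm u) (leg u).+1.
Proof.
move=> gamma_pos; pose N := between gamma.
have N_perm mu : perm_eq mu gamma -> between mu =2 N.
  by move=> p k r; apply/seq.permP.
have perm_prod mu (F : nat -> nat -> R) : perm_eq mu gamma ->
    \prod_(c < size mu) F (nth 0%N mu c) (later_equals mu c) =
    \prod_(k <- undup gamma) \prod_(e < count_mem k gamma) F k e.
  move=> p; rewrite (@prod_later_equals _ (undup gamma)) ?undup_uniq //.
    by apply: eq_bigr => k _; rewrite (seq.permP p).
  by move=> k; rewrite mem_undup (perm_mem p).
(* Products along one column of height [k] with [e] equal columns to its right. *)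
pose Fdec k e := \prod_(r < k) f (e + N k r)%N (k - r.+1)%N.
pose Finc k e := \prod_(r < k | (0 < r)%N) f (e + N k r.-1)%N (k - r.+1).+1.
have perm_dec : perm_eq (dec gamma) gamma by rewrite perm_sort.
have perm_inc : perm_eq (inc gamma) gamma by rewrite perm_sort.
transitivity (\prod_(k <- undup gamma) \prod_(e < count_mem k gamma) Fdec k e).
  rewrite -(perm_prod _ _ perm_dec) -(big_cell _ (fun _ _ => true)
    (fun c r => f (later_equals (dec gamma) c + N (nth 0%N (dec gamma) c) r)%N
                  (nth 0%N (dec gamma) c - r.+1)%N)).
  by apply: eq_bigr => u _; rewrite legE arm_dec N_perm.
have -> : \prod_(u : cell (inc gamma) | above_bottom u) f (arm u) (leg u).+1 =
    \prod_(k <- undup gamma) \prod_(e < count_mem k gamma) Finc k e.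
  rewrite -(perm_prod _ _ perm_inc) -(big_cell _ (fun _ r => (0 < r)%N)
    (fun c r => f (later_equals (inc gamma) c + N (nth 0%N (inc gamma) c) r.-1)%N
                  (nth 0%N (inc gamma) c - r.+1).+1)).
  by apply: eq_bigr => u u0; rewrite legE arm_inc ?N_perm.
rewrite -big_split big_seq [RHS]big_seq; apply: eq_bigr => k.
(* Parts are positive, so every column has a top cell to split off. *)
rewrite mem_undup => /gamma_pos; case: k => // k _.
rewrite -big_split; apply: eq_bigr => e _.
rewrite /Fdec /Finc big_ord_recr [in RHS]big_mkcond [in RHS]big_ord_recl /=.
rewrite mul1r mulrC subnn.
have -> : N k.+1 k = 0%N.
  by apply/eqP; rewrite -leqn0 leqNgt -has_count; apply/hasPn => j _; lia.
rewrite addn0; congr (_ * _); apply: eq_bigr => r _.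
by congr f; rewrite /bump /=; have := ltn_ord r; lia.
Qed.

(** * The limit *)

(** The t-analogue of the real number [b]. *)
Definition powR_quot (R : realType) (b t : R) : R := (1 - t `^ b) / (1 - t).

(** This is the difference quotient of t^b at t = 1, where the derivative is b. *)
Lemma powR_quot_cvg (R : realType) (b : R) :
  powR_quot b t @[t --> 1^'-] --> b.
Proof.
have [] := @is_derive1_powR R b 1 ltr01; rewrite powR1 mulr1 => cvg_b lim_b.
have /cvgrPdist_lt H : (fun h : R =>
    h^-1 *: (((@powR R)^~ b \o shift 1) (h *: 1) - 1 `^ b)) @ 0^' --> b.
  by rewrite -[X in _ --> X]lim_b; exact: cvg_b.
apply/cvgrPdist_lt => e /H.
rewrite /dnbhs /within /= => /nbhs_ballP[d /= d0 {}H].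
near=> t.
have t1 : t < 1 by near: t; exact: nbhs_left_lt.
have td : 1 - d < t by near: t; apply: nbhs_left_gt; rewrite ltrBlDr ltrDl.
have := H (t - 1); rewrite /ball /= sub0r normrN subr_eq0 lt_eqF //.
rewrite ler0_norm ?subr_le0 ?ltW // opprB => /(_ _ isT).
rewrite /shift /= powR1 scaler1 subrK [_ *: _]mulrC.
rewrite -[t `^ b - 1]opprB -[t - 1]opprB invrN mulrNN.
by apply; rewrite ltrBlDr -ltrBlDl.
Unshelve. all: by end_near. Qed.

Lemma powR_cvg1 (R : realType) (a : R) : t `^ a @[t --> 1^'-] --> (1 : R).
Proof.
apply: cvg_at_left_filter.
have powR1a : (1 : R) `^ a = 1 by rewrite powR1.
rewrite -[X in _ --> X]powR1a.
apply: (@differentiable_continuous _ _ _ _ ((@powR R)^~ a)).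
apply/derivable1_diffP; apply: derivable_powR.
by rewrite in_itv /= ltr01.
Qed.

Lemma powR_quot_neq0 (R : realType) (b t : R) :
  0 < t < 1 -> b != 0 -> powR_quot b t != 0.
Proof.
move=> /andP[t0 t1] b0; rewrite mulf_neq0 ?invr_eq0 ?subr_eq0 // eq_sym.
  by rewrite powR_eq1 (negPf b0) lt_eqF //= ltNge ltW.
by rewrite lt_eqF.
Qed.

Lemma powRX (R : realType) (a t : R) k l : 0 < t ->
  (t `^ a) ^+ k * t ^+ l = t `^ (a * k%:R + l%:R).
Proof.
move=> t0; rewrite powRD ?[t == 0]gt_eqF ?implybT //.
by rewrite powRrM !powR_mulrn // ?powR_ge0 // ltW.
Qed.

Lemma jack_term (R : realType) (gamma : seq nat) (alpha t : R)
    (T : {ffun cell (inc gamma) -> nat}) :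
    let c (u : cell (inc gamma)) := alpha * (leg u).+1%:R + (arm u)%:R in
    strong_composition gamma ->
    (forall u, above_bottom u -> c u + 1 != 0) -> 0 < t < 1 ->
  jack_prefactor gamma (t `^ alpha) t * weight (t `^ alpha) t T =
  (\prod_(k <- undup gamma) \prod_(e < count_mem k gamma) powR_quot e.+1%:R t) *
  t `^ (alpha * (maj T)%:R + (coinv T)%:R) *
  \prod_(u | above_bottom u && (T u == T (South u))) powR_quot (c u + 1) t.
Proof.
move=> c gamma_pos c1 /[dup] t01 /andP[t0 t1].
have quotE a l : (1 - (t `^ alpha) ^+ l * t ^+ a.+1) / (1 - t) =
    powR_quot (alpha * l%:R + a%:R + 1) t.
  by rewrite powRX // -addrA -[1 in X in _ = X]/(1%:R) -natrD addn1.
rewrite /jack_prefactor.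
under eq_bigr do rewrite mulrC.
rewrite (prod_dec_inc (fun a l =>
  (1 - t)^-1 * (1 - t ^+ a.+1 * (t `^ alpha) ^+ l))) //.
rewrite /weight powRX // mulrACA; congr (_ * _ * _).
  apply: eq_bigr => k _; apply: eq_bigr => e _.
  by rewrite expr0 mulr1 mulrC /powR_quot powR_mulrn // ltW.
(* Where T(u) = T(South u) the prefactor alone contributes; at the other cells its factor meets its
   inverse in wt(T), and it is nonzero because c u + 1 is. *)
rewrite (bigID (fun u => T u == T (South u))) /= -mulrA -big_split /=.
rewrite [X in _ * X]big1 ?mulr1.
  by apply: eq_bigr => u _; rewrite mulrC [t ^+ _ * _]mulrC quotE.
move=> u /andP[u0 _]; rewrite [t ^+ _ * _]mulrC [(1 - t)^-1 * _]mulrC.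
by rewrite -[X in _ * X]invf_div quotE divff // powR_quot_neq0 ?c1.
Qed.

(** All labels lie in the support of [m]; the limit of a coefficient can thus be taken term by
    term. *)
Lemma finite_monomial (mu : seq nat) (m : {mset nat}%mset) :
  finite_set [set T : {ffun cell mu -> nat} | monomial T = m].
Proof.
pose lift (f : {ffun cell mu -> seq_sub (enum_mset m)}) : {ffun cell mu -> nat} :=
  [ffun u => ssval (f u)].
apply: (@sub_finite_set _ _ (lift @` setT)); last exact/finite_image/finite_finset.
move=> T /= Tm.
have T_m u : T u \in enum_mset m.
  rewrite -Tm (perm_mem (perm_eq_seq_mset _)).
  by apply/mapP; exists u; rewrite ?mem_enum.
exists [ffun u => SeqSub (T_m u)] => //.
by apply/ffunP => u; rewrite !ffunE.
Qed.

Lemma jack_deformation_cvg (R : realType) (gamma : seq nat) (alpha : R) m :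
    let c (u : cell (inc gamma)) := alpha * (leg u).+1%:R + (arm u)%:R in
    strong_composition gamma ->
    (forall u, above_bottom u -> c u + 1 != 0) ->
  jack_deformation gamma alpha t m @[t --> 1^'-] -->
  (\prod_(k <- undup gamma) (count_mem k gamma)`!)%:R *
  \sum_(T \in NAT gamma `&` [set T | monomial T = m])
    \prod_(u | above_bottom u && (T u == T (South u))) (c u + 1).
Proof.
move=> c gamma_pos c1.
have fin : finite_set (NAT gamma `&` [set T | monomial T = m]).
  by apply: sub_finite_set (@finite_monomial (inc gamma) m) => T [].
have -> : (\prod_(k <- undup gamma) (count_mem k gamma)`!)%:R =
    \prod_(k <- undup gamma) \prod_(e < count_mem k gamma) e.+1%:R :> R.
  rewrite natr_prod; apply: eq_bigr => k _.
  by rewrite fact_prod big_add1 /= big_mkord natr_prod.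
rewrite fsbig_finite //= mulr_sumr.
pose P0 : R := \prod_(k <- undup gamma) \prod_(e < count_mem k gamma) e.+1%:R.
(* The factor 1 is the limit of the power of t in [term]. *)
rewrite (eq_bigr (fun T : {ffun cell (inc gamma) -> nat} => P0 * 1 *
    \prod_(u | above_bottom u && (T u == T (South u))) (c u + 1))); last first.
  by move=> T _; rewrite mulr1.
pose term (T : {ffun cell (inc gamma) -> nat}) t :=
  (\prod_(k <- undup gamma) \prod_(e < count_mem k gamma)
     powR_quot e.+1%:R t) *
  t `^ (alpha * (maj T)%:R + (coinv T)%:R) *
  \prod_(u | above_bottom u && (T u == T (South u))) powR_quot (c u + 1) t.
have mul_cont : continuous (fun x : R * R => x.1 * x.2) by exact: mul_continuous.
have add_cont : continuous (fun x : R * R => x.1 + x.2) by exact: add_continuous.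
apply: (@cvg_trans _ (\sum_(T <- fset_set (NAT gamma `&` [set T | monomial T = m]))
    term T t @[t --> 1^'-])).
  apply: near_eq_cvg; near=> t.
  have t01 : 0 < t < 1.
    by apply/andP; split; near: t; [exact: nbhs_left_gt|exact: nbhs_left_lt].
  rewrite /jack_deformation /qsMacdonald /gen_series fsbig_finite //= mulr_sumr.
  by apply: eq_bigr => T _; rewrite jack_term.
apply: cvg_big => // T _; apply: cvgM; first apply: cvgM.
- apply: cvg_big => // k _; apply: cvg_big => // e _; exact: powR_quot_cvg.
- exact: powR_cvg1.
- apply: cvg_big => // u _; exact: powR_quot_cvg.
Unshelve. all: by end_near. Qed.

Unset Implicit Arguments.
Set Strict Implicit.

Theorem corollary4p2 (R : realType) (gamma : seq nat) (alpha : R)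
    (hgamma : strong_composition gamma)
    (halpha : forall u : cell (inc gamma), above_bottom u ->
        alpha * (leg u).+1%:R + (arm u)%:R + 1 != 0)
    (m : {mset nat}%mset) :
  cvg (jack_deformation gamma alpha t m @[t --> 1^'-]) /\
  qsJack gamma alpha m =
    (\prod_(k <- undup gamma) (count_mem k gamma)`!)%:R *
    jack_expansion gamma alpha m.
Proof.
have -> : m = seq_mset (sort leq m).
  by rewrite -[LHS]seq_mset_id; apply/eq_seq_msetP; rewrite perm_sym perm_sort.
have sorted_s : sorted leq (sort leq m) by exact/sort_sorted/leq_total.
have lim_J := @jack_deformation_cvg R gamma alpha (seq_mset (sort leq m))
  hgamma halpha.
split; first exact: cvgP lim_J.
by rewrite (jack_expansion_seq_mset halpha sorted_s); apply: cvg_lim lim_J.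
Qed.
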